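(* For every $\varepsilon\ge 0$ for which the family over which the infimum is taken is nonempty, the modulus of noncompact convexity of $(\mathbb{R}^2,d^* )$ with respect to the Kuratowski measure of noncompactness $\alpha$, $$\triangle_{\mathbb{R}^2,\alpha}(\varepsilon)=\inf\{1-d^*((0,0),A)\ \mid\ A\subseteq B((0,0),1),\ A \text{ nonempty, convex and closed},\ \alpha(A)\ge\varepsilon\},$$ is equal to $$\triangle_{\mathbb{R}^2,\alpha}(\varepsilon)=\frac{\varepsilon}{2}.$$
   Context: The river metric $d^*$ on $\mathbb{R}^2$ is defined, for $v_1=(x_1,y_1)$ and $v_2=(x_2,y_2)$, by $d^*(v_1,v_2)=|y_1-y_2|$ if $x_1=x_2$, and $d^*(v_1,v_2)=|y_1|+|y_2|+|x_1-x_2|$ if $x_1\ne x_2$. $B((0,0),1)$ is the open unit ball of $d^*$ centred at the origin, closedness is with respect to $d^*$, and $d^*((0,0),A)=\inf\{d^*((0,0),v): v\in A\}$. The metric segment between $v_1,v_2$ is $[v_1,v_2]=\{z\in\mathbb{R}^2: d^*(v_1,v_2)=d^*(v_1,z)+d^*(z,v_2)\}$, and a nonempty set $A\subset\mathbb{R}^2$ is convex if $[v_1,v_2]\subset A$ for all $v_1,v_2\in A$. For a bounded set $D$ in $(\mathbb{R}^2,d^* )$, the Kuratowski measure of noncompactness $\alpha(D)$ is the infimum of all $\varepsilon>0$ such that $D$ can be covered by finitely many sets of diameter not larger than $\varepsilon$. *)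

(* Defs.v *)
From HB Require Import structures.
From mathcomp Require Import all_boot all_order all_algebra.
From mathcomp Require Import ring lra.
From mathcomp Require Import all_classical all_reals all_analysis.

Set Implicit Arguments.
Unset Strict Implicit.
Unset Printing Implicit Defensive.

Import Order.TTheory GRing.Theory Num.Theory.

Local Open Scope classical_set_scope.
Local Open Scope ring_scope.

(* A copy of the plane, so that the river metric does not compete with the
   product topology that R * R carries canonically. *)
Definition river (R : realType) : Type := (R * R)%type.

HB.instance Definition _ (R : realType) := Choice.copy (river R) (R * R)%type.

Definition river_dist (R : realType) (v1 v2 : river R) : R :=
  if v1.1 == v2.1 then `|v1.2 - v2.2|
  else `|v1.2| + `|v2.2| + `|v1.1 - v2.1|.

Lemma river_distxx (R : realType) (v : river R) : river_dist v v = 0.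
Proof. by rewrite /river_dist eqxx subrr normr0. Qed.

Lemma river_dist_eq0 (R : realType) (v1 v2 : river R) :
  river_dist v1 v2 = 0 -> v1 = v2.
Proof.
case: v1 v2 => [x1 y1] [x2 y2]; rewrite /river_dist /=.
case: eqP => [-> /normr0_eq0/eqP|x12 d0].
  by rewrite subr_eq0 => /eqP ->.
have x12_gt0 : 0 < `|x1 - x2| by rewrite normr_gt0 subr_eq0; apply/eqP.
have y1_ge0 := normr_ge0 y1; have y2_ge0 := normr_ge0 y2.
by exfalso; lra.
Qed.

Lemma river_dist_sym (R : realType) (v1 v2 : river R) :
  river_dist v1 v2 = river_dist v2 v1.
Proof.
by rewrite /river_dist eq_sym (distrC v1.2) (distrC v1.1) (addrC `|v1.2|).
Qed.

Lemma river_dist_triangle (R : realType) (w v1 v2 : river R) :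
  river_dist v1 v2 <= river_dist v1 w + river_dist w v2.
Proof.
case: w v1 v2 => [x y] [x1 y1] [x2 y2]; rewrite /river_dist /=.
have tx := ler_distD x x1 x2; have ty := ler_distD y y1 y2.
have n12 := ler_normB y1 y2.
have n1 := ler_distD y y1 0; have n2 := ler_distD y 0 y2.
have y0 := normr_ge0 y; have x10 := normr_ge0 (x1 - x).
have x20 := normr_ge0 (x - x2).
rewrite !subr0 !sub0r !normrN in n1 n2.
case: (eqVneq x1 x) => [x1x|_]; case: (eqVneq x x2) => [xx2|_]; last 1 first.
- by case: eqP => _; lra.
- by rewrite x1x xx2 eqxx; lra.
- by rewrite x1x; case: eqP => [xx2|_]; lra.
- by rewrite -xx2; case: eqP => [x1x|_]; lra.
Qed.

HB.instance Definition _ (R : realType) := @isMetric.Build R (river R)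
  (@river_dist R) (@river_distxx R) (@river_dist_eq0 R) (@river_dist_sym R)
  (@river_dist_triangle R).

Section metric_notions.
Context {R : realType} {T : metricType R}.
Implicit Types (x y z : T) (A D : set T).

Definition metric_segment x y : set T :=
  [set z | mdist x y = mdist x z + mdist z y].

(* Nonemptiness is not built in: it is a separate condition below. *)
Definition metric_convex A : Prop :=
  forall x y, A x -> A y -> metric_segment x y `<=` A.

(* Meaningful for nonempty A only: inf set0 is 0. *)
Definition dist_to_set x A : R := inf [set mdist x a | a in A].

(* Extended-real valued, so that an unbounded set has diameter +oo; the empty
   set has diameter -oo, and is thus a harmless member of any cover. *)
Definition diameter A : \bar R :=
  ereal_sup [set (mdist x y)%:E | x in A & y in A].

(* Meaningful for bounded D, for which the infimum is over a nonempty set. *)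
Definition kuratowski D : R :=
  inf [set e : R | 0 < e /\
    exists2 F : set (set T), finite_set F &
      D `<=` \bigcup_(U in F) U /\
      (forall U, F U -> (diameter U <= e%:E)%E)].

(* The sets over which the modulus of noncompact convexity is an infimum, for
   a base point o and a measure of noncompactness phi. *)
Definition modulus_family (o : T) (phi : set T -> R) (e : R) : set (set T) :=
  [set A | [/\ A `<=` ball o 1, A !=set0, metric_convex A, closed A
             & e <= phi A]].

Definition noncompact_convexity_modulus
    (o : T) (phi : set T -> R) (e : R) : R :=
  inf [set 1 - dist_to_set o A | A in modulus_family o phi e].

End metric_notions.

Definition river_origin (R : realType) : river R := (0, 0).

(* Main.v *)
Require Import Defs.
From mathcomp Require Import all_boot all_order all_algebra.
From mathcomp Require Import lra.
From mathcomp Require Import all_classical all_reals all_analysis.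
Import Order.TTheory GRing.Theory Num.Theory.
Local Open Scope classical_set_scope.
Local Open Scope ring_scope.

(** The origin sits on the river, the axis y = 0, and the distance from it is
    |x| + |y|; two points on different verticals are joined only through their
    feet on the river.

    Lower bound.  Let A be in the family and t its distance from the origin.
    If A meets two verticals, convexity puts the foot (x, 0) of each point
    (x, y) of A into A, so t <= |x|, and |x| + |y| < 1 gives |y| <= 1 - t: the
    set A consists of vertical hairs of length at most 2 (1 - t).  Cutting A
    into finitely many strips of thin width, each of diameter at most
    2 (1 - t) up to that width, yields alpha(A) <= 2 (1 - t)
    ([kuratowski_le_fibers]).  If A lies on one vertical it is totally bounded
    and alpha(A) = 0.  In both cases e / 2 <= 1 - t ([modulus_family_ge]).

    Upper bound.  For 0 <= t <= r the wedge {x >= t, |x| + |y| <= r} is closed,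
    convex and at distance t from the origin.  With r = t + q + e / 2, q > 0, it contains
    the points (x, e / 2) for all x in [t, t + q].  Any two of them are at
    distance at least e, since the way between them goes down to the river and
    up again; so no finite cover by sets of diameter below e exists
    ([kuratowski_ge_separated]) and alpha of the wedge is at least e.  The
    wedge fits into the open unit ball as soon as r < 1, which a small q
    allows whenever e / 2 < 1 - t; so 1 - t can be any number above e / 2 and
    below 1 ([modulus_family_wedge]).  The infimum is at most 1, hence a value
    above e / 2 would leave room for such a number below it. *)

(** * The Kuratowski measure in a metric space *)

Section kuratowski.
Context {R : realType} {T : metricType R}.
Implicit Types (x y z : T) (A D : set T).

Lemma diameter_le A (M : R) :
  (forall x y, A x -> A y -> mdist x y <= M) -> (diameter A <= M%:E)%E.
Proof.
move=> AM; apply: ge_ereal_sup => _ [x Ax [y Ay <-]].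
by rewrite lee_fin; exact: AM.
Qed.

Lemma mdist_le_diameter {A} {M : R} {x y} :
  (diameter A <= M%:E)%E -> A x -> A y -> mdist x y <= M.
Proof.
move=> AM Ax Ay; rewrite -lee_fin; apply: le_trans AM.
by apply: ereal_sup_ubound; exists x => //; exists y.
Qed.

(** The fibres of g have diameter at most c.  Cutting the bounded range of g
    into finitely many intervals of length d cuts D into pieces of diameter at
    most c + d. *)
Lemma kuratowski_le_fibers D (g : T -> R) (M c : R) :
    0 <= c -> (forall x, D x -> `|g x| <= M) ->
    (forall x y, D x -> D y -> mdist x y <= c + `|g x - g y|) ->
  kuratowski D <= c.
Proof.
move=> c0 gM gD; apply/ler_addgt0Pr => d d0.
apply: ge_inf; first by exists 0 => e [/ltW].
split; first by rewrite ltr_wpDl.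
have Mk x : D x -> 0 <= (g x + M) / d.
  by move=> /gM; rewrite ler_norml => /andP[gx _]; rewrite divr_ge0 ?(ltW d0)//; lra.
(* The range of g lies in [-M, M], so g + M is nonnegative and truncation
   numbers the intervals of length d from 0 on. *)
pose cell k := D `&` [set x | Num.truncn ((g x + M) / d) = k].
exists (cell @` `I_(Num.truncn ((M + M) / d)).+1).
  exact/finite_image/finite_II.
split=> [x Dx|_ [k _ <-]].
  exists (cell (Num.truncn ((g x + M) / d))) => //.
  exists (Num.truncn ((g x + M) / d)) => //=.
  rewrite ltnS; apply: le_truncn; rewrite ler_pM2r ?invr_gt0// lerD2r.
  exact: le_trans (ler_norm _) (gM x Dx).
apply: diameter_le => x y [Dx xk] [Dy yk].
apply: (le_trans (gD x y Dx Dy)); rewrite lerD2l.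
have /andP[] := truncn_itv (Mk x Dx); have /andP[] := truncn_itv (Mk y Dy).
rewrite xk yk !ler_pdivlMr// !ltr_pdivrMr// -natr1 mulrDl mul1r.
by move=> ? ? ? ?; rewrite ler_norml; lra.
Qed.

(** Two terms of a c-separated sequence never share a set of diameter less than
    c, so a finite cover by such sets would inject nat into a finite set.  The
    bound M makes the infimum in the definition range over a nonempty set. *)
Lemma kuratowski_ge_separated D (u : nat -> T) (M c : R) :
    (forall x y, D x -> D y -> mdist x y <= M) ->
    (forall i, D (u i)) -> (forall i j, i != j -> c <= mdist (u i) (u j)) ->
  c <= kuratowski D.
Proof.
move=> DM Du sep; apply: lb_le_inf.
  exists (Num.max M 1); split; first by rewrite lt_max ltr01 orbT.
  exists [set D]; first exact: finite_set1.
  split=> [x Dx|_ ->]; first by exists D.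
  by apply: diameter_le => x y Dx Dy; rewrite le_max DM.
move=> e [_ [F finF [DF Fe]]]; rewrite leNgt; apply/negP => ec.
have /choice[U FU] i : exists U, F U /\ U (u i).
  by have [V ? ?] := DF _ (Du i); exists V.
apply: infinite_nat.
suff -> : [set: nat] = U @^-1` F.
  apply: finite_preimage finF => i j _ _ Uij; apply/eqP/negP => /negP ij.
  have [FUi Ui] := FU i; have [_ Uj] := FU j; rewrite -Uij in Uj.
  have := mdist_le_diameter (Fe _ FUi) Ui Uj.
  by apply/negP; rewrite -ltNge (lt_le_trans ec)// sep.
by apply/seteqP; split=> // i _; exact: (FU i).1.
Qed.

(** Both conditions that define the wedge below are of this form. *)
Lemma closed_sublevel_short (f : T -> R) (r : R) :
  (forall x y, f x <= f y + mdist x y) -> closed [set x | f x <= r].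
Proof.
move=> f1 x clx; apply/ler_addgt0Pr => d d0.
have [y [/= fy]] := clx _ (nbhsx_ballx x d d0).
rewrite ballEmdist /= => /ltW xy.
by apply: le_trans (f1 x y) _; exact: lerD.
Qed.

Lemma dist_to_set_le (o : T) {a A} : A a -> dist_to_set o A <= mdist o a.
Proof.
move=> Aa; apply: ge_inf; last by exists a.
by exists 0 => _ [z _ <-]; exact: mdist_ge0.
Qed.

Lemma dist_to_set_ge (o : T) A (t : R) : A !=set0 ->
  (forall a, A a -> t <= mdist o a) -> t <= dist_to_set o A.
Proof.
move=> [a Aa] tA; apply: lb_le_inf; first by exists (mdist o a), a.
by move=> _ [b Ab <-]; exact: tA.
Qed.

End kuratowski.

(** * The lower bound *)

Section river.
Context {R : realType}.
Implicit Types (v w z : river R) (A : set (river R)).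

Lemma river_mdistE v w : mdist v w = river_dist v w.
Proof. by []. Qed.

Lemma river_dist_origin v : mdist (river_origin R) v = `|v.1| + `|v.2|.
Proof.
rewrite river_mdistE /river_dist /= !sub0r !normrN normr0 add0r addrC.
by case: eqP => // <-; rewrite normr0 add0r.
Qed.

Lemma river_dist_ge v w : v.1 != w.1 -> `|v.2| + `|w.2| <= mdist v w.
Proof.
by move=> /negbTE vw; rewrite river_mdistE /river_dist vw lerDl normr_ge0.
Qed.

Lemma river_dist_le v w : mdist v w <= `|v.2| + `|w.2| + `|v.1 - w.1|.
Proof.
rewrite river_mdistE /river_dist; case: eqP => // vw.
by rewrite (le_trans (ler_normB _ _))// lerDl.
Qed.

Lemma river_foot v w : v.1 != w.1 -> metric_segment v w (v.1, 0).
Proof.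
move=> /negbTE vw; rewrite /metric_segment /= !river_mdistE /river_dist /= vw.
by rewrite eqxx subr0 normr0 add0r addrA.
Qed.

Lemma river_abscissa_short v w : v.1 <= w.1 + mdist v w.
Proof.
rewrite river_mdistE /river_dist; case: eqP => [->|_]; first by rewrite lerDl.
have := ler_norm (v.1 - w.1); have := normr_ge0 v.2; have := normr_ge0 w.2.
lra.
Qed.

(** Either A lies on one vertical, where the ordinate is an isometry and alpha
    vanishes, or A contains the feet of its points, which bounds the ordinates
    by 1 - t. *)
Lemma modulus_family_ge {e A} :
    modulus_family (river_origin R) kuratowski e A ->
  e / 2 <= 1 - dist_to_set (river_origin R) A.
Proof.
case=> Aball [a Aa] Aconv _ eA; set t := dist_to_set _ A.
have A1 v : A v -> `|v.1| + `|v.2| < 1.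
  by move=> /Aball; rewrite ballEmdist /= river_dist_origin.
have t1 : t < 1.
  by apply: le_lt_trans (dist_to_set_le _ Aa) _; rewrite river_dist_origin A1.
have [[w [Aw aw]]|Aline] := pselect (exists w, A w /\ w.1 != a.1); last first.
  suff : kuratowski A <= 0 by lra.
  apply: (kuratowski_le_fibers A (fun v => v.2) 1) => // [v Av|v w Av Aw].
    by have := A1 v Av; have := normr_ge0 v.1; lra.
  have line z : A z -> z.1 = a.1.
    by move=> Az; apply/eqP/negP => /negP za; apply: Aline; exists z.
  by rewrite add0r river_mdistE /river_dist !line// eqxx.
(* Some point of A lies off the vertical of v: w if v shares the vertical of a,
   and a otherwise. *)
have Afoot v : A v -> A (v.1, 0).
  move=> Av; have [va|va] := eqVneq v.1 a.1.
    by apply: (Aconv v w) => //; apply: river_foot; rewrite va eq_sym.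
  by apply: (Aconv v a) => //; exact: river_foot.
have Ah v : A v -> `|v.2| <= 1 - t.
  move=> Av; have := dist_to_set_le (river_origin R) (Afoot v Av).
  by rewrite river_dist_origin /= normr0 -/t; have := A1 v Av; lra.
suff : kuratowski A <= 2 * (1 - t) by lra.
apply: (kuratowski_le_fibers A (fun v => v.1) 1) => [|v Av|v z Av Az]; first by lra.
  by have := A1 v Av; have := normr_ge0 v.2; lra.
by have := river_dist_le v z; have := Ah v Av; have := Ah z Az; lra.
Qed.

(** * Wedges, and the upper bound *)

(** Truncated on the left at abscissa t and bounded by a closed ball around the
    origin; the sign in - v.1 <= - t makes both conditions sublevel sets of
    functions with Lipschitz constant 1. *)
Definition river_wedge (t r : R) : set (river R) :=
  [set v | mdist (river_origin R) v <= r] `&` [set v | - v.1 <= - t].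

Lemma river_wedge_closed t r : closed (river_wedge t r).
Proof.
apply: closedI; apply: closed_sublevel_short => v w.
  by rewrite (metric_sym v); exact: metric_triangle.
by have := river_abscissa_short w v; rewrite metric_sym; lra.
Qed.

(** A segment between different verticals descends to the river, runs along it
    and climbs again.  The four cases say whether the intermediate point is on
    the vertical of each of the end points. *)
Lemma river_wedge_convex t r : metric_convex (river_wedge t r).
Proof.
move=> [x1 y1] [x2 y2] [/=]; rewrite river_dist_origin /= => r1 t1.
move=> [/=]; rewrite river_dist_origin /= => r2 t2 [x y].
rewrite /metric_segment /= !river_mdistE /river_dist /= => E.
rewrite /river_wedge /= river_dist_origin /=.
suff [? ?] : `|x| + `|y| <= r /\ - x <= - t by [].
move: E; case: (eqVneq x1 x) => [?|n1]; case: (eqVneq x x2) => [?|n2]; subst.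
- rewrite eqxx => E; split => //; move: r1 r2 E.
  by case: (ger0P y); case: (ger0P y1); case: (ger0P y2); case: (ger0P (y1 - y2));
     case: (ger0P (y1 - y)); case: (ger0P (y - y2)); lra.
- rewrite (negbTE n2) => E; split => //.
  by have := ler_distD y1 y 0; rewrite !subr0 distrC; lra.
- rewrite (negbTE n1) => E; split => //.
  by have := ler_distD y2 y 0; rewrite !subr0; lra.
(* Off both verticals the detour to the point costs 2 |y|, so the equality in
   E forces the point onto the river, between the two abscissae. *)
- have := normr_ge0 y => y0.
  move=> E; have : `|x1 - x| + `|x - x2| + 2 * `|y| <= `|x1 - x2|.
    move: E; case: eqP => [->|_]; last by lra.
    by rewrite subrr normr0; have := ler_normB y1 y2; lra.
  move: r1 r2 (normr_ge0 y1) (normr_ge0 y2) y0 {E n1 n2}.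
  case: (ger0P x1); case: (ger0P x2); case: (ger0P x); case: (ger0P (x1 - x));
  by case: (ger0P (x - x2)); case: (ger0P (x1 - x2)); lra.
Qed.

(** The horizontal row of points at height h over [t, t + s] stays inside the
    wedge and is 2 h-separated. *)
Lemma river_wedge_kuratowski t h s : 0 <= t -> 0 <= h -> 0 < s ->
  2 * h <= kuratowski (river_wedge t (t + s + h)).
Proof.
move=> t0 h0 s0; pose x (n : nat) : R := t + s / n.+1%:R.
have xs n : t <= x n <= t + s.
  rewrite /x lerDl lerD2l divr_ge0 ?(ltW s0)//= ler_pdivrMr//.
  by rewrite ler_peMr ?(ltW s0)// ler1n.
apply: (@kuratowski_ge_separated _ _ _ (fun n => (x n, h) : river R)
    (2 * (t + s + h))) => [v w [/= vr _] [/= wr _]|n|i j ij].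
- apply: (le_trans (metric_triangle v (river_origin R) w)).
  by rewrite (metric_sym v); lra.
- have /andP[tx xts] := xs n.
  split; rewrite /= ?lerN2// river_dist_origin /=.
  by rewrite !ger0_norm// ?lerD2r//; exact: le_trans tx.
- have xij : x i != x j.
    apply: contraNneq ij => /addrI/(mulfI (lt0r_neq0 s0))/invr_inj/eqP.
    by rewrite eqr_nat eqSS.
  by have := @river_dist_ge (x i, h) (x j, h) xij; rewrite /= ger0_norm//; lra.
Qed.

(** With t = 1 - s and q half of s - e / 2, the radius t + q + e / 2 is 1 - q,
    just below 1. *)
Lemma modulus_family_wedge e s : 0 <= e -> e / 2 < s -> s < 1 ->
  exists2 A, modulus_family (river_origin R) kuratowski e A &
    1 - dist_to_set (river_origin R) A <= s.
Proof.
move=> e0 es s1; pose t := 1 - s; pose q := (s - e / 2) / 2.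
have t0 : 0 <= t by rewrite /t; lra.
have q0 : 0 < q by rewrite /q; lra.
have W0 : river_wedge t (t + q + e / 2) (t, 0).
  split; rewrite /= ?river_dist_origin//= normr0 ger0_norm//; lra.
exists (river_wedge t (t + q + e / 2)).
  split.
  - by move=> v [/= vr _]; rewrite ballEmdist /=; move: vr; rewrite /t /q; lra.
  - by exists (t, 0).
  - exact: river_wedge_convex.
  - exact: river_wedge_closed.
  - have e20 : 0 <= e / 2 by lra.
    by have := river_wedge_kuratowski t _ _ t0 e20 q0; lra.
suff : t <= dist_to_set (river_origin R) (river_wedge t (t + q + e / 2)).
  by rewrite /t; lra.
apply: dist_to_set_ge; first by exists (t, 0).
move=> v [_ /=]; rewrite lerN2 river_dist_origin => tv.
by have := ler_norm v.1; have := normr_ge0 v.2; lra.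
Qed.

End river.

Theorem mainTheorem3 (R : realType) (e : R) (he : 0 <= e)
    (hne : modulus_family (river_origin R) kuratowski e !=set0) :
  noncompact_convexity_modulus (river_origin R) kuratowski e = e / 2.
Proof.
rewrite /noncompact_convexity_modulus; set V := (X in inf X).
have lbV : lbound V (e / 2) by move=> _ [A Ae <-]; exact: modulus_family_ge.
have infV_le v : V v -> inf V <= v by apply: ge_inf; exists (e / 2).
have [A Ae] := hne; have VA : V (1 - dist_to_set (river_origin R) A) by exists A.
apply/eqP; rewrite eq_le lb_le_inf ?andbT//; last by eexists; exact: VA.
rewrite leNgt; apply/negP => einf.
have inf1 : inf V <= 1.
  apply: (le_trans (infV_le _ VA)); rewrite lerBlDr lerDl.
  by apply: dist_to_set_ge => [|a _]; [case: Ae | exact: mdist_ge0].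
have [||B Be Bs] := @modulus_family_wedge R e ((e / 2 + inf V) / 2) he; try lra.
by have := infV_le _ (ex_intro2 _ _ B Be erefl); lra.
Qed.
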